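(* Let $R$ be a commutative ring with non-zero identity. If $R$ is a quasi presimplifiable ring and $I$ is a weakly $J$-ideal of $R$, then $R/I$ is a quasi presimplifiable ring.
   Context: $J(R)$, $N(R)$ and $U(R)$ denote the Jacobson radical, the nilradical and the set of units of $R$, respectively. A ring $R$ is quasi presimplifiable if whenever $a,b\in R$ with $a=ab$, then $a\in N(R)$ or $b\in U(R)$. A proper ideal $I$ of $R$ is a weakly $J$-ideal if whenever $a,b\in R$ with $0\neq ab\in I$ and $a\notin J(R)$, then $b\in I$. *)

(* Defs.v *)
From HB Require Import structures.
From mathcomp Require Import all_boot all_order all_algebra.
From mathcomp Require Import all_classical.

Set Implicit Arguments.
Unset Strict Implicit.
Unset Printing Implicit Defensive.

Import GRing.Theory.
Local Open Scope classical_set_scope.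
Local Open Scope ring_scope.

(* A commutative ring with 1 != 0 is a [comNzRingType], and a proper ideal is an
   [idealr]: this structure includes 1 \notin I.  Its carrier is a boolean
   predicate, which is no restriction: classically every predicate is boolean,
   by [asbool]. *)

Section QuasiPresimplifiable.
Variable R : comNzRingType.
Implicit Types I M : idealr R.

(* [GRing.unit] would need a [unitRingType] structure, which [{ideal_quot I}]
   does not carry. *)
Definition ring_units : set R := [set u | exists v, u * v = 1].

Definition nilradical : set R := [set a | exists n, a ^+ n = 0].

(* [N] ranges over the proper ideals only. *)
Definition maximal_ideal M : Prop :=
  forall N : idealr R, {subset M <= N} -> {subset N <= M}.

Definition jacobson_radical : set R :=
  [set a | forall M, maximal_ideal M -> a \in M].

Definition quasi_presimplifiable : Prop :=
  forall a b : R, a = a * b -> nilradical a \/ ring_units b.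

Definition weakly_J_ideal I : Prop :=
  forall a b : R, a * b != 0 -> a * b \in I -> ~ jacobson_radical a -> b \in I.

End QuasiPresimplifiable.

Arguments ring_units R : clear implicits.
Arguments nilradical R : clear implicits.
Arguments jacobson_radical R : clear implicits.
Arguments quasi_presimplifiable R : clear implicits.

(* Main.v *)
Require Import Defs.
From HB Require Import structures.
From mathcomp Require Import all_boot all_order all_algebra.
From mathcomp Require Import all_classical.

(** If [a = a b] modulo [I] then [a (1 - b)] lies in [I].  Either this product
    is zero, and quasi presimplifiability of [R] applies; or [1 - b] is not in
    [J(R)], and then [a] lies in [I]; or [1 - b] is in [J(R)], and then [b] is a
    unit, being in no maximal ideal. *)

Set Implicit Arguments.
Unset Strict Implicit.
Unset Printing Implicit Defensive.

Import GRing.Theory.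
Local Open Scope classical_set_scope.
Local Open Scope ring_scope.
Local Open Scope quotient_scope.

(** Classical decidability, through [asbool], makes [P] a boolean carrier. The ideals built below
    are given by existential predicates. *)
Lemma ideal_of_pred (R : nzRingType) (P : R -> Prop) :
  P 0 -> ~ P 1 -> (forall a x y, P x -> P y -> P (a * x + y)) ->
  exists I : idealr R, forall x, x \in I <-> P x.
Proof.
move=> P0 P1 PD; pose S : R -> bool := fun x => `[< P x >].
have SI : idealr_closed S.
  split; rewrite ?unfold_in; [exact/asboolP | exact/asboolPn |].
  move=> a x y; rewrite !unfold_in => /asboolP Px /asboolP Py.
  by apply/asboolP; exact: PD.
pose M := isIdealr.Build R S SI.
pose I : idealr R := HB.pack S M.
by exists I => x; split => /asboolP.
Qed.

(** Zorn's lemma on the proper ideals containing [I], preordered by inclusion. *)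
Lemma maximal_ideal_exists (R : comNzRingType) (I : idealr R) :
  exists2 M : idealr R, maximal_ideal M & {subset I <= M}.
Proof.
pose T := {N : idealr R | {subset I <= N}}.
pose le : rel T := fun M N => `[< {subset sval M <= sval N} >].
have [] := @ZL_preorder T (exist _ I (fun x => id)) le.
- by move=> M; apply/asboolP => x.
- move=> N M P /asboolP MN /asboolP NP.
  by apply/asboolP => x /MN /NP.
- move=> A totA; have [[M0 AM0]|A0] := pselect (exists M, A M); last first.
    (* The union of an empty chain is not an ideal; [I] itself is a bound here. *)
    by exists (exist _ I (fun x => id)) => M AM; case: A0; exists M.
  (* A nonempty chain is bounded by its union, which is proper because no member contains 1. *)
  pose P x := exists2 M : T, A M & x \in sval M.
  have [|[M _]||U UP] := @ideal_of_pred R P.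
  + by exists M0; rewrite ?idealr0.
  + by rewrite idealr1.
  + move=> a x y [M AM xM] [N AN yN].
    (* The larger of the two ideals contains both [x] and [y]. *)
    have [/asboolP MN|/asboolP NM] := totA M N AM AN.
      by exists N => //; rewrite rpredD ?idealMr // MN.
    by exists M => //; rewrite rpredD ?idealMr // NM.
  have IU : {subset I <= U}.
    by move=> x Ix; apply/UP; exists M0 => //; exact: (svalP M0).
  by exists (exist _ U IU) => M AM; apply/asboolP => x xM; apply/UP; exists M.
move=> [M IM] maxM; exists M => // N MN.
have IN : {subset I <= N} by move=> x /IM /MN.
by have /asboolP := maxM (exist _ N IN) (asboolT MN).
Qed.

(** The principal ideal [b R] is proper, since [b] has no inverse, and so lies in a maximal
    ideal. *)
Lemma nonunit_in_maximal (R : comNzRingType) (b : R) :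
  ~ ring_units R b -> exists2 M : idealr R, maximal_ideal M & b \in M.
Proof.
move=> bU; pose P x := exists r, x = b * r.
have [||a _ _ [r ->] [s ->]|I IP] := @ideal_of_pred R P.
- by exists 0; rewrite mulr0.
- by move=> [r br]; apply: bU; exists r.
- by exists (a * r + s); rewrite mulrDr mulrCA.
have [M maxM IM] := maximal_ideal_exists I.
by exists M => //; apply/IM/IP; exists 1; rewrite mulr1.
Qed.

(** A maximal ideal containing [b] would also contain [(1 - b) + b = 1]. *)
Lemma jacobson_radical_unit (R : comNzRingType) (b : R) :
  jacobson_radical R (1 - b) -> ring_units R b.
Proof.
move=> Jb; apply: contrapT => /nonunit_in_maximal[M maxM bM].
by have := rpredD (Jb _ maxM) bM; rewrite subrK idealr1.
Qed.

Theorem proposition9 (R : comNzRingType) (I : idealr R) :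
  quasi_presimplifiable R -> weakly_J_ideal I ->
  quasi_presimplifiable {ideal_quot I}.
Proof.
move=> qR wI x y; elim/quotW: x => a; elim/quotW: y => b.
have unit_pi : ring_units R b -> ring_units {ideal_quot I} (\pi b).
  by move=> [v bv]; exists (\pi v); rewrite -rmorphM bv rmorph1.
rewrite -rmorphM => /eqP; rewrite -Quotient.idealrBE => abI.
(* The factor [1 - b] comes first because [weakly_J_ideal] tests the first factor against the
   radical and puts the second in [I]. *)
have eqab : (1 - b) * a = a - a * b by rewrite mulrBl mul1r mulrC.
have [ab0|ab0] := eqVneq ((1 - b) * a) 0.
  have /qR[[n an]|/unit_pi] : a = a * b; last by right.
    by apply/subr0_eq; rewrite -eqab.
  by left; exists n; rewrite -rmorphXn an rmorph0.
have [/jacobson_radical_unit/unit_pi|J1b] :=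
  pselect (jacobson_radical R (1 - b)); first by right.
(* The exponent 1 suffices: [a] lies in [I], so its class is already zero. *)
left; exists 1; rewrite expr1; apply/eqP.
rewrite -(rmorph0 (\pi_{ideal_quot I})) -Quotient.idealrBE subr0.
by apply: wI J1b; rewrite ?eqab // -eqab.
Qed.
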